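(* Let $(a,b,c)$ be a primitive Pythagorean triple with $a<b<c$, and put $d=c-b$ and $d'=c-a$. Then $d$ and $d'$ are allowable values, and the point $(a,b)$ of the $xy$-plane lies at an intersection of the graphs of the two parabolas $$y=\frac{x^2-d^2}{2d}\qquad\text{and}\qquad x=\frac{y^2-d'^2}{2d'}.$$
   Context: A Pythagorean triple is a triple $(a,b,c)$ of positive integers with $a^2+b^2=c^2$. It is primitive (a PPT) if $\gcd(a,b,c)=1$. A positive integer $d$ is called allowable if it determines a PPT, i.e. if there is a primitive Pythagorean triple $(u,v,w)$ (with $u^2+v^2=w^2$, the legs $u,v$ being in either order of size) such that $d=w-v$. The sequence of allowable values begins $1,2,8,9,18,25,32,49,50,\dots$. *)

(* Defs.v *)
From mathcomp Require Import all_boot all_order all_algebra.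
From mathcomp Require Import classical_sets reals.
Set Implicit Arguments.
Unset Strict Implicit.
Unset Printing Implicit Defensive.
Import Order.TTheory GRing.Theory Num.Theory.
Local Open Scope classical_set_scope.
Local Open Scope ring_scope.

Definition pythagorean_triple (a b c : nat) : Prop :=
  [/\ (0 < a)%N, (0 < b)%N, (0 < c)%N & (a ^ 2 + b ^ 2 = c ^ 2)%N].

Definition primitive_pythagorean_triple (a b c : nat) : Prop :=
  pythagorean_triple a b c /\ gcdn (gcdn a b) c = 1%N.

(* The legs u and v may be in either order of size. The truncated subtraction
   is harmless: u > 0 and u ^ 2 + v ^ 2 = w ^ 2 force v < w. *)
Definition allowable (d : nat) : Prop :=
  (0 < d)%N /\
  exists u v w : nat, primitive_pythagorean_triple u v w /\ d = (w - v)%N.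

Definition vertical_parabola (R : realType) (d : R) : set (R * R) :=
  [set p | p.2 = (p.1 ^+ 2 - d ^+ 2) / (2 * d)].

Definition horizontal_parabola (R : realType) (d : R) : set (R * R) :=
  [set p | p.1 = (p.2 ^+ 2 - d ^+ 2) / (2 * d)].

(* Main.v *)
Require Import Defs.
From mathcomp Require Import all_boot all_order all_algebra.
From mathcomp Require Import classical_sets reals.
From mathcomp Require Import ring.
Import Order.TTheory GRing.Theory Num.Theory.
Local Open Scope classical_set_scope.
Local Open Scope ring_scope.

(** Fix a leg [v] and put [e = w - v].  Substituting [w = v + e] in
    [u ^ 2 + v ^ 2 = w ^ 2] cancels the squares of [v] and leaves the relation
    [u ^ 2 = 2 * e * v + e ^ 2], which is linear in [v]; solving it for [v]
    gives the equation of a parabola ([leg_on_parabola]).  A primitive triple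
    stays primitive when its legs are exchanged, so either leg may play the
    role of [v]: the choice [v = b] gives the first parabola and [v = a] the
    second one.  The same two choices exhibit [c - b] and [c - a] as
    allowable. *)

Lemma primitive_pythagorean_triple_swap (u v w : nat) :
  primitive_pythagorean_triple u v w -> primitive_pythagorean_triple v u w.
Proof.
by case=> -[u0 v0 w0 uvw] guvw; split; [split; rewrite // addnC | rewrite (gcdnC v)].
Qed.

Lemma primitive_pythagorean_triple_allowable (u v w : nat) :
  primitive_pythagorean_triple u v w -> (v < w)%N -> allowable (w - v).
Proof. by move=> uvw ltvw; split; [rewrite subn_gt0 | exists u, v, w]. Qed.

Lemma leg_on_parabola (F : numFieldType) (u v w : nat) :
  (u ^ 2 + v ^ 2 = w ^ 2)%N -> (v < w)%N ->
  v%:R = (u%:R ^+ 2 - (w - v)%:R ^+ 2) / (2 * (w - v)%:R) :> F.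
Proof.
move=> uvw ltvw; have e_neq0 : (w - v)%:R != 0 :> F.
  by rewrite pnatr_eq0 -lt0n subn_gt0.
have -> : u%:R ^+ 2 = w%:R ^+ 2 - v%:R ^+ 2 :> F.
  by rewrite -!natrX -uvw natrD addrK.
move: e_neq0; rewrite natrB ?(ltnW ltvw) // => e_neq0.
by field.
Qed.

Theorem proposition1 (R : realType) (a b c d d' : nat)
  (habc : primitive_pythagorean_triple a b c)
  (hab : (a < b)%N) (hbc : (b < c)%N)
  (hd : d = (c - b)%N) (hd' : d' = (c - a)%N) :
  [/\ allowable d, allowable d' &
      ((a%:R, b%:R) : R * R) \in
        vertical_parabola d%:R `&` horizontal_parabola d'%:R].
Proof.
have hac := ltn_trans hab hbc.
have hbac := primitive_pythagorean_triple_swap _ _ _ habc.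
rewrite {}hd {}hd'; split.
- exact: primitive_pythagorean_triple_allowable habc hbc.
- exact: primitive_pythagorean_triple_allowable hbac hac.
have [[_ _ _ abc] _] := habc; have [[_ _ _ bac] _] := hbac.
by apply/mem_set; split; apply: leg_on_parabola.
Qed.
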